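(* (i) The timelike general rotational surface of first type $\mathcal{M}_1$ is flat if and only if, up to parametrization, the meridian curve is determined by $c: x(u)=(f(u),0,0,u)$, where $f(u)$ is a solution to the differential equation $$\left(\ln\left|\frac{1+f'}{1-f'}\right|\right)' = \frac{-2\alpha^2\beta^2\,(f-uf')^2}{(\alpha^2 f+\beta^2 u f')(\alpha^2 f^2+\beta^2u^2)}.$$ (ii) The timelike general rotational surface of second type $\mathcal{M}_2$ is flat if and only if, up to parametrization, the meridian curve is determined by $c: x(u)=(f(u),0,u,0)$, where $f(u)$ is a solution to the differential equation $$(\arctan f')' = \frac{\alpha^2\beta^2\,(uf'-f)^2}{(\alpha^2f^2-\beta^2u^2)(\alpha^2 f+\beta^2 u f')}.$$
   Context: $\mathbb{R}^4_1$ is the four-dimensional Minkowski space, i.e. $\mathbb{R}^4$ with the flat metric $\langle\cdot,\cdot\rangle = dx_1^2+dx_2^2+dx_3^2-dx_4^2$. A surface in it is timelike if the induced metric has index 1. Let $J\subset\mathbb{R}$ be an interval, $f,g$ smooth functions on $J$, $\alpha,\beta$ positive constants, $u\in J$, $v\in[0,2\pi)$; a prime denotes $d/du$. Timelike general rotational surface of first type: $$\mathcal{M}_1: z(u,v)=(f(u)\cos\alpha v,\ f(u)\sin\alpha v,\ g(u)\sinh\beta v,\ g(u)\cosh\beta v),$$ where $f'^2-g'^2<0$ and $\alpha^2f^2+\beta^2g^2>0$. Its meridian curve is $c: x(u)=(f(u),0,0,g(u))$. Timelike general rotational surface of second type: $$\mathcal{M}_2: z(u,v)=(f(u)\cos\alpha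 v,\ f(u)\sin\alpha v,\ g(u)\cosh\beta v,\ g(u)\sinh\beta v),$$ where $\alpha^2f^2-\beta^2g^2<0$ and $f'^2+g'^2>0$. Its meridian curve is $c: x(u)=(f(u),0,g(u),0)$. Standing assumption: all surfaces are free of inflection points. This means that, for an orthonormal normal frame $\{n_1,n_2\}$ and $c_{11}^k=\langle z_{uu},n_k\rangle$, $c_{12}^k=\langle z_{uv},n_k\rangle$, $c_{22}^k=\langle z_{vv},n_k\rangle$ ($k=1,2$), the three determinants $\Delta_1=c_{11}^1c_{12}^2-c_{12}^1c_{11}^2$, $\Delta_2=c_{11}^1c_{22}^2-c_{22}^1c_{11}^2$, $\Delta_3=c_{12}^1c_{22}^2-c_{22}^1c_{12}^2$ do not all vanish at any point. A surface is flat if its Gauss curvature $K$ (of the induced metric) is zero.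
   Formalization: In (ii) a flat surface can have g'=0 at isolated points, where the meridian is no graph (f(u),0,u,0); so flatness is shown equivalent to the graph/ODE form on each arc with g'≠0 (such points being dense), and the literal equivalence is shown with g'≠0 added to flatness. *)

(* Defs.v *)
From Stdlib Require Import Reals.
From Coquelicot Require Import Coquelicot.
Open Scope R_scope.

(** * Minkowski space and parametrized surfaces *)

Record vec4 : Type := Vec4 { x1 : R; x2 : R; x3 : R; x4 : R }.

Definition mink (a b : vec4) : R :=
  x1 a * x1 b + x2 a * x2 b + x3 a * x3 b - x4 a * x4 b.

(* The coordinate directions of the parameter plane. *)
Inductive dir : Type := du | dv.

Definition pd (i : dir) (h : R -> R -> R) (u v : R) : R :=
  match i with
  | du => Derive (fun s => h s v) u
  | dv => Derive (fun s => h u s) v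
  end.

Definition pdv (i : dir) (z : R -> R -> vec4) (u v : R) : vec4 :=
  Vec4 (pd i (fun a b => x1 (z a b)) u v) (pd i (fun a b => x2 (z a b)) u v)
       (pd i (fun a b => x3 (z a b)) u v) (pd i (fun a b => x4 (z a b)) u v).

(** * Gauss curvature of the induced metric *)

Definition sum_dir (t : dir -> R) : R := t du + t dv.

Definition induced_metric (z : R -> R -> vec4) (i j : dir) (u v : R) : R :=
  mink (pdv i z u v) (pdv j z u v).

Definition metric_det (m : dir -> dir -> R -> R -> R) (u v : R) : R :=
  m du du u v * m dv dv u v - m du dv u v * m dv du u v.

Definition metric_inv (m : dir -> dir -> R -> R -> R) (i j : dir) (u v : R) : R :=
  match i, j with
  | du, du => m dv dv u v / metric_det m u v
  | du, dv => - m du dv u v / metric_det m u v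
  | dv, du => - m dv du u v / metric_det m u v
  | dv, dv => m du du u v / metric_det m u v
  end.

(* Gamma^k_{ij} of the Levi-Civita connection. *)
Definition christoffel (m : dir -> dir -> R -> R -> R) (k i j : dir) (u v : R) : R :=
  / 2 * sum_dir (fun l => metric_inv m k l u v *
          (pd i (m j l) u v + pd j (m i l) u v - pd l (m i j) u v)).

(* R(d_i, d_j) d_k = sum over l of (riemann m l k i j) d_l, where
   R(X, Y) = [nabla_X, nabla_Y] - nabla_[X, Y]. *)
Definition riemann (m : dir -> dir -> R -> R -> R) (l k i j : dir) (u v : R) : R :=
  pd i (christoffel m l j k) u v - pd j (christoffel m l i k) u v
  + sum_dir (fun p => christoffel m p j k u v * christoffel m l i p u v
                      - christoffel m p i k u v * christoffel m l j p u v).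

(* K = <R(d_u, d_v) d_v, d_u> / (EG - F^2); the unit sphere has K = 1. *)
Definition gauss_curvature (z : R -> R -> vec4) (u v : R) : R :=
  let m := induced_metric z in
  sum_dir (fun l => riemann m l dv du dv u v * m l du u v) / metric_det m u v.

(** * Intervals, smoothness, flatness, inflection points *)

Definition interval (J : R -> Prop) : Prop :=
  (forall a b x : R, J a -> J b -> a <= x <= b -> J x)
  /\ (exists a b : R, J a /\ J b /\ a < b).

(* J need not be open: as usual for arbitrary subsets of R, smoothness at an
   endpoint belonging to J means smoothness of an extension past it. The
   derivatives at such an endpoint depend only on the values on J. *)
Definition smooth_on (J : R -> Prop) (f : R -> R) : Prop :=
  forall u : R, J u -> locally u (fun x => forall n : nat, ex_derive_n f n x).

Definition flat (J : R -> Prop) (z : R -> R -> vec4) : Prop :=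
  forall u v : R, J u -> 0 <= v < 2 * PI -> gauss_curvature z u v = 0.

(* The normal planes of a timelike surface are positive definite, so an
   orthonormal frame consists of two vectors of square 1. *)
Definition orthonormal_normal_frame
    (z : R -> R -> vec4) (u v : R) (n1 n2 : vec4) : Prop :=
  mink n1 n1 = 1 /\ mink n2 n2 = 1 /\ mink n1 n2 = 0 /\
  (forall i : dir, mink n1 (pdv i z u v) = 0 /\ mink n2 (pdv i z u v) = 0).

(* Changing the orthonormal frame multiplies each determinant by 1 or -1, so
   quantifying over all frames at the point is the same as fixing one. *)
Definition inflection_free (J : R -> Prop) (z : R -> R -> vec4) : Prop :=
  forall (u v : R) (n1 n2 : vec4),
    J u -> 0 <= v < 2 * PI -> orthonormal_normal_frame z u v n1 n2 ->
    let c11 n := mink (pdv du (pdv du z) u v) n in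
    let c12 n := mink (pdv dv (pdv du z) u v) n in
    let c22 n := mink (pdv dv (pdv dv z) u v) n in
    ~ (c11 n1 * c12 n2 - c12 n1 * c11 n2 = 0 /\
       c11 n1 * c22 n2 - c22 n1 * c11 n2 = 0 /\
       c12 n1 * c22 n2 - c22 n1 * c12 n2 = 0).

(** * The two types of surfaces and their meridian curves *)

Definition surf1 (alpha beta : R) (f g : R -> R) (u v : R) : vec4 :=
  Vec4 (f u * cos (alpha * v)) (f u * sin (alpha * v))
       (g u * sinh (beta * v)) (g u * cosh (beta * v)).

Definition surf2 (alpha beta : R) (f g : R -> R) (u v : R) : vec4 :=
  Vec4 (f u * cos (alpha * v)) (f u * sin (alpha * v))
       (g u * cosh (beta * v)) (g u * sinh (beta * v)).

Definition meridian1 (f g : R -> R) (u : R) : vec4 := Vec4 (f u) 0 0 (g u).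
Definition meridian2 (f g : R -> R) (u : R) : vec4 := Vec4 (f u) 0 (g u) 0.

(* The curve c on J is a smooth regular reparametrization of d on I. *)
Definition reparametrizes (J : R -> Prop) (c : R -> vec4)
    (I : R -> Prop) (d : R -> vec4) : Prop :=
  exists phi : R -> R,
    smooth_on J phi
    /\ (forall u : R, J u -> Derive phi u <> 0)
    /\ (forall t : R, I t <-> exists u : R, J u /\ phi u = t)
    /\ (forall u : R, J u -> c u = d (phi u)).

(** * The differential equations *)

(* Being a solution includes that both sides of the equation make sense, since
   division by zero and ln 0 are total in Rocq. *)
Definition solution1 (alpha beta : R) (I : R -> Prop) (f : R -> R) : Prop :=
  smooth_on I f /\
  forall u : R, I u ->
    1 + Derive f u <> 0 /\ 1 - Derive f u <> 0 /\
    (alpha^2 * f u + beta^2 * u * Derive f u)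
      * (alpha^2 * (f u)^2 + beta^2 * u^2) <> 0 /\
    is_derive (fun t => ln (Rabs ((1 + Derive f t) / (1 - Derive f t)))) u
      (- 2 * alpha^2 * beta^2 * (f u - u * Derive f u)^2
       / ((alpha^2 * f u + beta^2 * u * Derive f u)
          * (alpha^2 * (f u)^2 + beta^2 * u^2))).

Definition solution2 (alpha beta : R) (I : R -> Prop) (f : R -> R) : Prop :=
  smooth_on I f /\
  forall u : R, I u ->
    (alpha^2 * (f u)^2 - beta^2 * u^2)
      * (alpha^2 * f u + beta^2 * u * Derive f u) <> 0 /\
    is_derive (fun t => atan (Derive f t)) u
      (alpha^2 * beta^2 * (u * Derive f u - f u)^2
       / ((alpha^2 * (f u)^2 - beta^2 * u^2)
          * (alpha^2 * f u + beta^2 * u * Derive f u))).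

(** * "Up to parametrization, the meridian is a graph solving the equation" *)

Definition graph_meridian1 (alpha beta : R) (J : R -> Prop) (f g : R -> R) : Prop :=
  exists (I : R -> Prop) (h : R -> R),
    interval I
    /\ reparametrizes J (meridian1 f g) I (meridian1 h (fun t => t))
    /\ solution1 alpha beta I h.

Definition graph_meridian2 (alpha beta : R) (J : R -> Prop) (f g : R -> R) : Prop :=
  exists (I : R -> Prop) (h : R -> R),
    interval I
    /\ reparametrizes J (meridian2 f g) I (meridian2 h (fun t => t))
    /\ solution2 alpha beta I h.

(* For the second type g' may vanish at isolated points, even on a flat surface
   without inflection points; a meridian has no parametrization
   (h(t), 0, t, 0) around such a point. The description then applies to every
   arc on which g' does not vanish, and these arcs fill J densely (the equation
   says nothing about an arc on which g is constant, and there K <> 0). *)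
Definition piecewise_graph_meridian2
    (alpha beta : R) (J : R -> Prop) (f g : R -> R) : Prop :=
  (forall u eps : R, J u -> 0 < eps ->
     exists w : R, J w /\ Rabs (w - u) < eps /\ Derive g w <> 0)
  /\ (forall J' : R -> Prop,
        interval J' ->
        (forall u : R, J' u -> J u) ->
        (forall u : R, J' u -> Derive g u <> 0) ->
        graph_meridian2 alpha beta J' f g).

(* Main.v *)
Require Import Defs.
From Stdlib Require Import Reals Ranalysis5 Lra ClassicalEpsilon.
From Coquelicot Require Import Coquelicot.
Open Scope R_scope.

(** The induced metrics of both types are diagonal and depend on [u] alone.
    With a sign [s] equal to -1 for the first type and 1 for the second they
    share the formulas
      [E = f'^2 + s g'^2]  and  [G = alpha^2 f^2 - s beta^2 g^2],
    so one computation of the Gauss curvature serves for both, and it gives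
      [K = - s (W N G - alpha^2 beta^2 E D^2) / (E G)^2]
    where [W = f'' g' - f' g''], [N = alpha^2 f g' + beta^2 g f'] and
    [D = f g' - g f'].  The bracket is [flatness_defect], and flatness is its
    vanishing ([flat_iff_defect]).  On a graph, [g(u) = u], the vanishing reads
      [f'' N G = alpha^2 beta^2 (f'^2 + s) (f - u f')^2],
    and division by [f'^2 + s] and by [N G] turns [f''] into the derivative of
    [ln |(1 + f') / (1 - f')|], up to the factor -2, or of [arctan f']: this is
    the differential equation.

    The division by [N] is where inflection points enter.  At a flat point with
    [N = 0] the defect forces [D = 0]; if moreover [g' <> 0], the two linear
    relations [N = D = 0] force [f = f' = 0] ([flatness_defect_pivot]).  Then the
    tangent plane is the plane of the last two coordinates, it contains
    [z_uv] and [z_vv], and all three determinants vanish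
    ([inflection_free_rotation]).

    The passage to a graph rests on two facts.  The defect is homogeneous under
    reparametrization ([flatness_defect_reparam]), hence it can be tested on
    either parametrization; and where [g'] has no zero, [h] is [f] composed with
    the inverse of [g] ([exists_graph_over]).  For the first type [g' <> 0]
    holds because [f'^2 < g'^2].  For the second type, the defect
    of an arc with constant [g] is [- alpha^2 beta^2 g^2 f'^4], which is not
    zero; so on a flat surface the points with [g' <> 0] are dense, and
    conversely the vanishing of the defect extends from a dense set by
    continuity. *)

(** * The induced metric *)

Lemma pdv_du_surf1 : forall alpha beta f g u v,
  pdv du (surf1 alpha beta f g) u v
  = Vec4 (Derive f u * cos (alpha * v)) (Derive f u * sin (alpha * v))
         (Derive g u * sinh (beta * v)) (Derive g u * cosh (beta * v)).
Proof.
  intros alpha beta f g u v; unfold pdv, pd; simpl.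
  rewrite !Derive_scal_l; reflexivity.
Qed.

Lemma pdv_du_surf2 : forall alpha beta f g u v,
  pdv du (surf2 alpha beta f g) u v
  = Vec4 (Derive f u * cos (alpha * v)) (Derive f u * sin (alpha * v))
         (Derive g u * cosh (beta * v)) (Derive g u * sinh (beta * v)).
Proof.
  intros alpha beta f g u v; unfold pdv, pd; simpl.
  rewrite !Derive_scal_l; reflexivity.
Qed.

Lemma Derive_trig : forall c k v,
  Derive (fun s => c * cos (k * s)) v = - (c * k * sin (k * v)) /\
  Derive (fun s => c * sin (k * s)) v = c * k * cos (k * v) /\
  Derive (fun s => c * sinh (k * s)) v = c * k * cosh (k * v) /\
  Derive (fun s => c * cosh (k * s)) v = c * k * sinh (k * v).
Proof.
  intros c k v; unfold sinh, cosh.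
  repeat split; apply is_derive_unique; auto_derive; auto; field.
Qed.

Lemma pdv_dv_surf1 : forall alpha beta f g u v,
  pdv dv (surf1 alpha beta f g) u v
  = Vec4 (- (f u * alpha * sin (alpha * v))) (f u * alpha * cos (alpha * v))
         (g u * beta * cosh (beta * v)) (g u * beta * sinh (beta * v)).
Proof.
  intros alpha beta f g u v; unfold pdv, pd; simpl.
  destruct (Derive_trig (f u) alpha v) as (-> & -> & _).
  destruct (Derive_trig (g u) beta v) as (_ & _ & -> & ->); reflexivity.
Qed.

Lemma pdv_dv_surf2 : forall alpha beta f g u v,
  pdv dv (surf2 alpha beta f g) u v
  = Vec4 (- (f u * alpha * sin (alpha * v))) (f u * alpha * cos (alpha * v))
         (g u * beta * sinh (beta * v)) (g u * beta * cosh (beta * v)).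
Proof.
  intros alpha beta f g u v; unfold pdv, pd; simpl.
  destruct (Derive_trig (f u) alpha v) as (-> & -> & _).
  destruct (Derive_trig (g u) beta v) as (_ & _ & -> & ->); reflexivity.
Qed.

(** The sign [s] lets one development cover both types: it is -1 for the first
    and 1 for the second. *)
Definition rotational_metric (z : R -> R -> vec4) (s alpha beta : R)
    (f g : R -> R) : Prop :=
  forall u v,
    induced_metric z du du u v = (Derive f u)^2 + s * (Derive g u)^2
    /\ induced_metric z du dv u v = 0
    /\ induced_metric z dv du u v = 0
    /\ induced_metric z dv dv u v = alpha^2 * (f u)^2 - s * beta^2 * (g u)^2.

Lemma sin_cos_square : forall x, cos x ^ 2 = 1 - sin x ^ 2.
Proof. intros x; generalize (sin2_cos2 x); unfold Rsqr; lra. Qed.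

Lemma cosh_sinh_square : forall x, cosh x ^ 2 = 1 + sinh x ^ 2.
Proof.
  intros x; unfold cosh, sinh.
  assert (exp x * exp (- x) = 1) by (rewrite <- exp_plus, Rplus_opp_r; apply exp_0).
  nra.
Qed.

Lemma rotational_metric_surf1 : forall alpha beta f g,
  rotational_metric (surf1 alpha beta f g) (-1) alpha beta f g.
Proof.
  intros alpha beta f g u v; unfold induced_metric.
  rewrite pdv_du_surf1, pdv_dv_surf1.
  unfold mink; cbn [x1 x2 x3 x4].
  repeat split; ring_simplify;
    rewrite ?sin_cos_square, ?cosh_sinh_square; ring.
Qed.

Lemma rotational_metric_surf2 : forall alpha beta f g,
  rotational_metric (surf2 alpha beta f g) 1 alpha beta f g.
Proof.
  intros alpha beta f g u v; unfold induced_metric.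
  rewrite pdv_du_surf2, pdv_dv_surf2.
  unfold mink; cbn [x1 x2 x3 x4].
  repeat split; ring_simplify;
    rewrite ?sin_cos_square, ?cosh_sinh_square; ring.
Qed.

(** * The Gauss curvature of a diagonal metric depending on one parameter *)

Lemma locally_neq_0 : forall (F : R -> R) u,
  ex_derive F u -> F u <> 0 -> locally u (fun x => F x <> 0).
Proof.
  intros F u HF Hu.
  apply (ex_derive_continuous F u HF (fun y => y <> 0)).
  apply open_neq; exact Hu.
Qed.

(** The diagonal metric is required near [u], not only at [u], because the
    curvature differentiates it; its independence of [v] removes every
    derivative of a Christoffel symbol except that of
    [Gamma^u_vv = - G' / (2 E)]. *)
Lemma gauss_curvature_orthogonal : forall z (E G : R -> R) u v,
  locally u (fun s => forall w,
    induced_metric z du du s w = E s /\ induced_metric z du dv s w = 0 /\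
    induced_metric z dv du s w = 0 /\ induced_metric z dv dv s w = G s) ->
  ex_derive E u -> ex_derive G u -> ex_derive (Derive G) u ->
  E u <> 0 -> G u <> 0 ->
  gauss_curvature z u v
  = - (2 * E u * G u * Derive (Derive G) u - Derive E u * G u * Derive G u
       - E u * (Derive G u)^2) / (4 * (E u * G u)^2).
Proof.
  intros z E G u v Hm HE HG HG2 HE0 HG0.
  set (m := induced_metric z) in *.
  assert (Hdu : locally u (fun s => forall w,
     pd du (m du du) s w = Derive E s /\ pd du (m du dv) s w = 0 /\
     pd du (m dv du) s w = 0 /\ pd du (m dv dv) s w = Derive G s)).
  { generalize (locally_locally _ _ Hm); apply filter_imp; intros s Hs w.
    unfold pd; repeat split.
    - apply Derive_ext_loc; revert Hs; apply filter_imp; intros t Ht; apply Ht.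
    - rewrite <- (Derive_const 0 s).
      apply Derive_ext_loc; revert Hs; apply filter_imp; intros t Ht; apply Ht.
    - rewrite <- (Derive_const 0 s).
      apply Derive_ext_loc; revert Hs; apply filter_imp; intros t Ht; apply Ht.
    - apply Derive_ext_loc; revert Hs; apply filter_imp; intros t Ht; apply Ht. }
  assert (Hdv : locally u (fun s => forall i j w, pd dv (m i j) s w = 0)).
  { revert Hm; apply filter_imp; intros s Hs i j w; unfold pd.
    destruct i, j;
      (erewrite Derive_ext; [ apply Derive_const | intros t; simpl; apply Hs ]). }
  assert (Hc : locally u (fun s => forall w,
     christoffel m du du du s w = Derive E s / (2 * E s) /\
     christoffel m du du dv s w = 0 /\
     christoffel m du dv dv s w = - Derive G s / (2 * E s) /\
     christoffel m dv du dv s w = Derive G s / (2 * G s) /\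
     christoffel m dv dv dv s w = 0)).
  { generalize (filter_and _ _ (filter_and _ _ Hdu Hdv) (filter_and _ _ Hm
      (filter_and _ _ (locally_neq_0 _ _ HE HE0) (locally_neq_0 _ _ HG HG0)))).
    apply filter_imp; intros s [[Hu Hv] [Hs [HEs HGs]]] w.
    destruct (Hu w) as (U1 & U2 & U3 & U4), (Hs w) as (M1 & M2 & M3 & M4).
    unfold christoffel, sum_dir, metric_inv, metric_det.
    rewrite !Hv, ?U1, ?U2, ?U3, ?U4, ?M1, ?M2, ?M3, ?M4.
    repeat split; field; auto. }
  assert (Hcu := locally_singleton _ _ Hc); simpl in Hcu.
  assert (Hmu := locally_singleton _ _ Hm); simpl in Hmu.
  unfold gauss_curvature; fold m; cbv zeta.
  unfold sum_dir at 1, metric_det.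
  destruct (Hmu v) as (-> & -> & -> & ->).
  unfold riemann, sum_dir.
  destruct (Hcu v) as (-> & -> & -> & -> & ->).
  replace (pd dv (christoffel m du du dv) u v) with 0.
  2:{ unfold pd; symmetry.
      erewrite Derive_ext; [ apply Derive_const | intros t; simpl; apply Hcu ]. }
  replace (pd du (christoffel m du dv dv) u v)
    with (- (Derive (Derive G) u * E u - Derive G u * Derive E u) / (2 * (E u)^2)).
  { field; auto. }
  symmetry; unfold pd.
  rewrite (Derive_ext_loc _ (fun s => - Derive G s / (2 * E s))).
  2:{ revert Hc; apply filter_imp; intros s Hs; apply Hs. }
  apply is_derive_unique; auto_derive.
  { repeat split; auto; lra. }
  change (fun x : R => Derive G x) with (Derive G).
  change (fun x : R => G x) with G.
  change (fun x : R => E x) with E.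
  field; auto.
Qed.

(** * Flatness as a relation between the coordinates of the meridian *)

(** The arguments [f1], [f2] and [g1], [g2] stand for the first and second
    derivatives.  Writing the relation with [f] and [g] on the same footing,
    rather than for a graph, keeps it meaningful at the zeros of [g']. *)
Definition flatness_defect (s alpha beta f f1 f2 g g1 g2 : R) : R :=
  (f2 * g1 - f1 * g2) * (alpha^2 * f * g1 + beta^2 * g * f1)
    * (alpha^2 * f^2 - s * beta^2 * g^2)
  - alpha^2 * beta^2 * (f1^2 + s * g1^2) * (f * g1 - g * f1)^2.

Definition curve_defect (s alpha beta : R) (f g : R -> R) (u : R) : R :=
  flatness_defect s alpha beta (f u) (Derive f u) (Derive (Derive f) u)
                  (g u) (Derive g u) (Derive (Derive g) u).

Lemma smooth_at_derive : forall f u,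
  locally u (fun x => forall n, ex_derive_n f n x) ->
  locally u (fun x => ex_derive f x /\ ex_derive (Derive f) x
                      /\ ex_derive (Derive (Derive f)) x).
Proof.
  intros f u; apply filter_imp; intros x Hx.
  exact (conj (Hx 1%nat) (conj (Hx 2%nat) (Hx 3%nat))).
Qed.

Lemma smooth_on_derive : forall J f u, smooth_on J f -> J u ->
  ex_derive f u /\ ex_derive (Derive f) u /\ ex_derive (Derive (Derive f)) u.
Proof.
  intros J f u Hf Hu; exact (locally_singleton _ _ (smooth_at_derive f u (Hf u Hu))).
Qed.

(** By direct substitution, [2 E G G'' - E' G G' - E G'^2] is [4 s] times the
    defect as soon as [s^2 = 1]. *)
Lemma gauss_curvature_rotational : forall z s alpha beta f g J u v,
  s * s = 1 -> rotational_metric z s alpha beta f g ->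
  smooth_on J f -> smooth_on J g -> J u ->
  (Derive f u)^2 + s * (Derive g u)^2 <> 0 ->
  alpha^2 * (f u)^2 - s * beta^2 * (g u)^2 <> 0 ->
  gauss_curvature z u v
  = - s * curve_defect s alpha beta f g u
    / (((Derive f u)^2 + s * (Derive g u)^2)
       * (alpha^2 * (f u)^2 - s * beta^2 * (g u)^2))^2.
Proof.
  intros z s alpha beta f g J u v Hs Hz Hf Hg Hu HE HG.
  generalize (smooth_at_derive f u (Hf u Hu)) (smooth_at_derive g u (Hg u Hu)); intros Lf Lg.
  destruct (smooth_on_derive J f u Hf Hu) as (Hf1 & Hf2 & Hf3).
  destruct (smooth_on_derive J g u Hg Hu) as (Hg1 & Hg2 & Hg3).
  set (E := fun x => (Derive f x)^2 + s * (Derive g x)^2).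
  set (G := fun x => alpha^2 * (f x)^2 - s * beta^2 * (g x)^2).
  assert (DE : is_derive E u (2 * Derive f u * Derive (Derive f) u
                              + s * (2 * Derive g u * Derive (Derive g) u))).
  { unfold E; auto_derive; [ repeat split; assumption | ].
    change (fun x : R => Derive f x) with (Derive f).
    change (fun x : R => Derive g x) with (Derive g).
    change (fun x : R => f x) with f.
    change (fun x : R => g x) with g.
    ring. }
  set (G1 := fun x => 2 * alpha^2 * f x * Derive f x - 2 * s * beta^2 * g x * Derive g x).
  assert (DG : forall x, ex_derive f x -> ex_derive g x -> is_derive G x (G1 x)).
  { intros x Hfx Hgx; unfold G, G1; auto_derive; [ repeat split; assumption | ].
    change (fun x : R => f x) with f.
    change (fun x : R => g x) with g.
    ring. }
  assert (DG1 : is_derive G1 u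
     (2 * alpha^2 * ((Derive f u)^2 + f u * Derive (Derive f) u)
      - 2 * s * beta^2 * ((Derive g u)^2 + g u * Derive (Derive g) u))).
  { unfold G1; auto_derive; [ repeat split; assumption | ].
    change (fun x : R => Derive f x) with (Derive f).
    change (fun x : R => Derive g x) with (Derive g).
    change (fun x : R => f x) with f.
    change (fun x : R => g x) with g.
    ring. }
  assert (LG : locally u (fun x => G1 x = Derive G x)).
  { generalize (filter_and _ _ Lf Lg); apply filter_imp; intros x [Hfx Hgx].
    symmetry; apply is_derive_unique, DG; tauto. }
  apply (is_derive_ext_loc _ _ _ _ LG) in DG1.
  rewrite (gauss_curvature_orthogonal z E G).
  - rewrite (is_derive_unique _ _ _ DE), (is_derive_unique _ _ _ DG1),
            (is_derive_unique _ _ _ (DG u Hf1 Hg1)).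
    unfold curve_defect, flatness_defect, E, G, G1.
    set (f0 := f u) in *; set (f1 := Derive f u) in *; set (f2 := Derive (Derive f) u) in *.
    set (g0 := g u) in *; set (g1 := Derive g u) in *; set (g2 := Derive (Derive g) u) in *.
    assert (s = 1 \/ s = -1) as [-> | ->] by (destruct (Req_dec s 1); [ tauto | right; nra ]);
      field; split; lra.
  - apply filter_forall; intros x w; apply Hz.
  - eexists; exact DE.
  - eexists; exact (DG u Hf1 Hg1).
  - eexists; exact DG1.
  - exact HE.
  - exact HG.
Qed.

Lemma flat_iff_defect : forall z s alpha beta f g J,
  s * s = 1 -> rotational_metric z s alpha beta f g ->
  smooth_on J f -> smooth_on J g ->
  (forall u, J u -> (Derive f u)^2 + s * (Derive g u)^2 <> 0
    /\ alpha^2 * (f u)^2 - s * beta^2 * (g u)^2 <> 0) ->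
  (flat J z <-> forall u, J u -> curve_defect s alpha beta f g u = 0).
Proof.
  intros z s alpha beta f g J Hs Hz Hf Hg Hn; split.
  - intros H u Hu; destruct (Hn u Hu) as [HE HG].
    assert (HK : gauss_curvature z u 0 = 0)
      by (apply H; [ exact Hu | generalize PI_RGT_0; lra ]).
    rewrite (gauss_curvature_rotational z s alpha beta f g J) in HK by assumption.
    apply Rmult_integral in HK; destruct HK as [HK | HK].
    + destruct (Req_dec s 0); [ subst; lra | nra ].
    + exfalso; revert HK; apply Rinv_neq_0_compat, pow_nonzero, Rmult_integral_contrapositive; auto.
  - intros H u v Hu _; destruct (Hn u Hu) as [HE HG].
    rewrite (gauss_curvature_rotational z s alpha beta f g J), (H u Hu) by assumption.
    unfold Rdiv; ring.
Qed.

(** If [f] is the composite of [h] with [g], then [f1 * g1] and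
    [f2 * g1^2 + f1 * g2] are its derivatives, where [f1] and [f2] are those of
    [h]; the terms in [g2] cancel because [W = f2 * g1^3]. *)
Lemma flatness_defect_reparam : forall s alpha beta f f1 f2 g g1 g2,
  flatness_defect s alpha beta f (f1 * g1) (f2 * g1^2 + f1 * g2) g g1 g2
  = g1^4 * flatness_defect s alpha beta f f1 f2 g 1 0.
Proof. intros; unfold flatness_defect; ring. Qed.

(** When this coefficient vanishes, so does [D = f g1 - g f1], since the defect
    reduces to its second term.  The combinations
    [(alpha^2 + beta^2) f g1] and [(alpha^2 + beta^2) g f1] of the two are then
    zero. *)
Lemma flatness_defect_pivot : forall s alpha beta f f1 f2 g g1 g2,
  0 < alpha -> 0 < beta -> g1 <> 0 ->
  f1^2 + s * g1^2 <> 0 -> alpha^2 * f^2 - s * beta^2 * g^2 <> 0 ->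
  ~ (f = 0 /\ f1 = 0) ->
  flatness_defect s alpha beta f f1 f2 g g1 g2 = 0 ->
  alpha^2 * f * g1 + beta^2 * g * f1 <> 0.
Proof.
  intros s alpha beta f f1 f2 g g1 g2 Ha Hb Hg1 HE HG Hff HQ HN.
  assert (HA : 0 < alpha^2) by (apply pow_lt; assumption).
  assert (HB : 0 < beta^2) by (apply pow_lt; assumption).
  unfold flatness_defect in HQ; rewrite HN in HQ.
  assert (HD : f * g1 - g * f1 = 0).
  { apply Rsqr_0_uniq; unfold Rsqr.
    apply Rmult_eq_reg_l with (alpha^2 * beta^2 * (f1^2 + s * g1^2)).
    - lra.
    - repeat apply Rmult_integral_contrapositive_currified; lra. }
  assert (Hfg : (alpha^2 + beta^2) * (f * g1) = 0) by nra.
  assert (Hf : f = 0).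
  { apply Rmult_integral in Hfg; destruct Hfg as [Hfg | Hfg]; [ lra | ].
    apply Rmult_integral in Hfg; tauto. }
  subst f.
  assert (Hgf : g * f1 = 0) by lra.
  apply Rmult_integral in Hgf; destruct Hgf as [-> | ->]; [ | tauto ].
  apply HG; ring.
Qed.

(** * Derivatives along an interval *)

Lemma interval_ball : forall J u eps, interval J -> J u -> 0 < eps ->
  interval (fun x => J x /\ Rabs (x - u) < eps).
Proof.
  intros J u eps [Hc (a & b & Ha & Hb & Hab)] Hu He; split.
  - intros p q x [Hp Hpu] [Hq Hqu] Hx; split; [ exact (Hc p q x Hp Hq Hx) | ].
    apply Rabs_def2 in Hpu; apply Rabs_def2 in Hqu; apply Rabs_def1; lra.
  - destruct (Rlt_or_le u b) as [Hub | Hbu].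
    + exists u, (Rmin b (u + eps / 2)).
      assert (Hm : u < Rmin b (u + eps / 2)) by (apply Rmin_glb_lt; lra).
      assert (Hm1 := Rmin_l b (u + eps / 2)); assert (Hm2 := Rmin_r b (u + eps / 2)).
      repeat split; [ exact Hu | | | | exact Hm ].
      * rewrite Rminus_eq_0, Rabs_R0; exact He.
      * apply (Hc u b); auto; lra.
      * apply Rabs_def1; lra.
    + exists (Rmax a (u - eps / 2)), u.
      assert (Hm : Rmax a (u - eps / 2) < u) by (apply Rmax_lub_lt; lra).
      assert (Hm1 := Rmax_l a (u - eps / 2)); assert (Hm2 := Rmax_r a (u - eps / 2)).
      repeat split; [ | | exact Hu | | exact Hm ].
      * apply (Hc a u); auto; lra.
      * apply Rabs_def1; lra.
      * rewrite Rminus_eq_0, Rabs_R0; exact He.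
Qed.

(** An endpoint of [J] is allowed: the difference quotients of the two-sided
    derivative may be taken along points of [J] only.  Hence derivatives at
    points of [J] do not see how a function is extended past [J]. *)
Lemma Derive_eq_on_interval : forall J p q u,
  interval J -> J u -> (forall x, J x -> p x = q x) ->
  ex_derive p u -> ex_derive q u -> Derive p u = Derive q u.
Proof.
  intros J p q u HJ Hu Heq Hp Hq.
  assert (Hd : is_derive (fun x => p x - q x) u (Derive p u - Derive q u))
    by (apply (is_derive_minus (V := R_NormedModule)); apply Derive_correct; assumption).
  apply is_derive_Reals in Hd.
  destruct (Req_dec (Derive p u - Derive q u) 0) as [H0 | H0]; [ lra | exfalso ].
  destruct (Hd _ (Rabs_pos_lt _ H0)) as [delta Hdelta].
  destruct (interval_ball J u delta HJ Hu (cond_pos delta))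
    as [_ (a & b & [Ha Hau] & [Hb Hbu] & Hab)].
  assert (Hw : exists w, J w /\ Rabs (w - u) < delta /\ w <> u).
  { destruct (Req_dec a u) as [-> | Hne]; [ exists b | exists a ]; repeat split; auto; lra. }
  destruct Hw as (w & Hw & Hwu & Hne).
  specialize (Hdelta (w - u) ltac:(lra) Hwu).
  replace (u + (w - u)) with w in Hdelta by ring.
  rewrite (Heq w Hw), (Heq u Hu) in Hdelta.
  replace ((q w - q w - (q u - q u)) / (w - u) - (Derive p u - Derive q u))
    with (- (Derive p u - Derive q u)) in Hdelta by (field; lra).
  rewrite Rabs_Ropp in Hdelta; lra.
Qed.

(** * Meridians that are graphs *)

(** A reparametrization to a graph has no freedom: comparing last coordinates
    shows that the change of parameter is [g] itself on [J]. *)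
Definition graph_over (J : R -> Prop) (f g : R -> R)
    (I : R -> Prop) (h : R -> R) : Prop :=
  (forall u, J u -> Derive g u <> 0)
  /\ (forall t, I t <-> exists u, J u /\ g u = t)
  /\ (forall u, J u -> f u = h (g u)).

Lemma reparametrizes_iff_graph_over : forall J f g I h c d,
  (forall u t, c u = d t <-> f u = h t /\ g u = t) ->
  interval J -> smooth_on J g ->
  (reparametrizes J c I d <-> graph_over J f g I h).
Proof.
  intros J f g I h c d Hcd HJ Hg; split.
  - intros (phi & Hphi & Hne & HI & Heq).
    assert (Hgphi : forall u, J u -> g u = phi u)
      by (intros u Hu; exact (proj2 (proj1 (Hcd _ _) (Heq u Hu)))).
    repeat split.
    + intros u Hu.
      rewrite (Derive_eq_on_interval J g phi u); auto.
      * exact (proj1 (smooth_on_derive J g u Hg Hu)).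
      * exact (proj1 (smooth_on_derive J phi u Hphi Hu)).
    + intros Ht; apply HI in Ht; destruct Ht as (u & Hu & <-); exists u; auto.
    + intros (u & Hu & <-); apply HI; exists u; split; [ exact Hu | symmetry; auto ].
    + intros u Hu; rewrite (Hgphi u Hu); exact (proj1 (proj1 (Hcd _ _) (Heq u Hu))).
  - intros (Hne & HI & Hf).
    exists g; repeat split; auto; try apply HI.
    intros u Hu; apply Hcd; auto.
Qed.

Lemma reparametrizes_meridian1 : forall J f g I h,
  interval J -> smooth_on J g ->
  (reparametrizes J (meridian1 f g) I (meridian1 h (fun t => t)) <-> graph_over J f g I h).
Proof.
  intros J f g I h; apply reparametrizes_iff_graph_over.
  intros u t; unfold meridian1; split.
  - intros H; injection H; auto.
  - intros [-> ->]; reflexivity.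
Qed.

Lemma reparametrizes_meridian2 : forall J f g I h,
  interval J -> smooth_on J g ->
  (reparametrizes J (meridian2 f g) I (meridian2 h (fun t => t)) <-> graph_over J f g I h).
Proof.
  intros J f g I h; apply reparametrizes_iff_graph_over.
  intros u t; unfold meridian2; split.
  - intros H; injection H; auto.
  - intros [-> ->]; reflexivity.
Qed.

Lemma graph_over_chain_rule : forall J f g I h,
  interval J -> smooth_on J f -> smooth_on J g -> smooth_on I h ->
  graph_over J f g I h -> forall u, J u ->
  Derive f u = Derive h (g u) * Derive g u /\
  Derive (Derive f) u
    = Derive (Derive h) (g u) * (Derive g u)^2 + Derive h (g u) * Derive (Derive g) u.
Proof.
  intros J f g I h HJ Hf Hg Hh (_ & HI & Heq).
  assert (HIg : forall u, J u -> I (g u)) by (intros u Hu; apply HI; exists u; auto).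
  assert (H1 : forall u, J u -> Derive f u = Derive h (g u) * Derive g u).
  { intros u Hu.
    destruct (smooth_on_derive J f u Hf Hu) as (Hf1 & _).
    destruct (smooth_on_derive J g u Hg Hu) as (Hg1 & _).
    destruct (smooth_on_derive I h (g u) Hh (HIg u Hu)) as (Hh1 & _).
    rewrite (Derive_eq_on_interval J f (fun x => h (g x)) u); auto.
    - rewrite (Derive_comp h g u Hh1 Hg1); apply Rmult_comm.
    - apply (ex_derive_comp h g u); auto. }
  intros u Hu; split; [ apply H1; exact Hu | ].
  destruct (smooth_on_derive J f u Hf Hu) as (_ & Hf2 & _).
  destruct (smooth_on_derive J g u Hg Hu) as (Hg1 & Hg2 & _).
  destruct (smooth_on_derive I h (g u) Hh (HIg u Hu)) as (_ & Hh2 & _).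
  assert (Hd : is_derive (fun x => Derive h (g x) * Derive g x) u
    (Derive (Derive h) (g u) * (Derive g u)^2 + Derive h (g u) * Derive (Derive g) u)).
  { auto_derive; [ repeat split; assumption | ].
    change (fun x : R => Derive h x) with (Derive h);
    change (fun x : R => Derive g x) with (Derive g);
    change (fun x : R => g x) with g; ring. }
  rewrite (Derive_eq_on_interval J (Derive f) (fun x => Derive h (g x) * Derive g x) u); auto.
  - apply is_derive_unique, Hd.
  - eexists; exact Hd.
Qed.

Lemma curve_defect_graph : forall s alpha beta J f g I h,
  interval J -> smooth_on J f -> smooth_on J g -> smooth_on I h ->
  graph_over J f g I h -> forall u, J u ->
  curve_defect s alpha beta f g u
  = (Derive g u)^4 * flatness_defect s alpha beta (h (g u)) (Derive h (g u))
                       (Derive (Derive h) (g u)) (g u) 1 0.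
Proof.
  intros s alpha beta J f g I h HJ Hf Hg Hh Hgr u Hu.
  destruct (graph_over_chain_rule J f g I h HJ Hf Hg Hh Hgr u Hu) as [H1 H2].
  destruct Hgr as (_ & _ & H0).
  unfold curve_defect; rewrite H2, H1, (H0 u Hu).
  apply flatness_defect_reparam.
Qed.

Lemma graph_over_defect : forall s alpha beta J f g I h,
  interval J -> smooth_on J f -> smooth_on J g -> smooth_on I h ->
  graph_over J f g I h ->
  ((forall u, J u -> curve_defect s alpha beta f g u = 0) <->
   (forall t, I t -> flatness_defect s alpha beta (h t) (Derive h t)
                       (Derive (Derive h) t) t 1 0 = 0)).
Proof.
  intros s alpha beta J f g I h HJ Hf Hg Hh Hgr.
  assert (Heq := curve_defect_graph s alpha beta J f g I h HJ Hf Hg Hh Hgr).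
  destruct Hgr as (Hne & HI & _); split.
  - intros H t Ht; apply HI in Ht; destruct Ht as (u & Hu & <-).
    specialize (H u Hu); rewrite (Heq u Hu) in H.
    apply Rmult_integral in H; destruct H as [H | H]; [ | exact H ].
    exfalso; exact (pow_nonzero _ 4 (Hne u Hu) H).
  - intros H u Hu; rewrite (Heq u Hu), H; [ ring | ].
    apply HI; exists u; auto.
Qed.

(** * The differential equations on a graph *)

Lemma is_derive_unique_iff : forall (F : R -> R) (x l l' : R),
  is_derive F x l -> (is_derive F x l' <-> l = l').
Proof.
  intros F x l l' H; split.
  - intros H'; rewrite <- (is_derive_unique _ _ _ H); apply is_derive_unique; exact H'.
  - intros <-; exact H.
Qed.

Lemma Rdiv_eq_iff : forall a b c d, b <> 0 -> d <> 0 ->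
  (a / b = c / d <-> a * d = c * b).
Proof.
  intros a b c d Hb Hd; split; intros H.
  - replace a with (a / b * b) by (field; assumption).
    rewrite H; field; assumption.
  - replace c with (c * b / b) by (field; assumption).
    rewrite <- H; field; auto.
Qed.

(** The derivative on the left is [2 h'' / (1 - h'^2)], and [1 - h'^2] is
    [- (h'^2 + s)] for [s = -1]. *)
Lemma solution1_equation : forall alpha beta h t,
  ex_derive (Derive h) t -> 1 + Derive h t <> 0 -> 1 - Derive h t <> 0 ->
  (alpha^2 * h t + beta^2 * t * Derive h t) * (alpha^2 * (h t)^2 + beta^2 * t^2) <> 0 ->
  (is_derive (fun t => ln (Rabs ((1 + Derive h t) / (1 - Derive h t)))) t
      (- 2 * alpha^2 * beta^2 * (h t - t * Derive h t)^2
       / ((alpha^2 * h t + beta^2 * t * Derive h t)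
          * (alpha^2 * (h t)^2 + beta^2 * t^2)))
   <-> flatness_defect (-1) alpha beta (h t) (Derive h t) (Derive (Derive h) t) t 1 0 = 0).
Proof.
  intros alpha beta h t Hh Hp Hm HD.
  assert (Hq : (1 + Derive h t) / (1 - Derive h t) <> 0)
    by (apply Rmult_integral_contrapositive_currified; [ | apply Rinv_neq_0_compat ]; assumption).
  assert (Hd : is_derive (fun t => ln (Rabs ((1 + Derive h t) / (1 - Derive h t)))) t
                 (2 * Derive (Derive h) t / ((1 + Derive h t) * (1 - Derive h t)))).
  { auto_derive.
    - repeat split; auto. apply Rabs_pos_lt; exact Hq.
    - change (fun x : R => Derive h x) with (Derive h).
      destruct (Rlt_or_le 0 ((1 + Derive h t) / (1 - Derive h t))) as [Hs | Hs].
      + unfold Rdiv, Rminus in Hs.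
        rewrite (sign_eq_1 _ Hs), (Rabs_pos_eq _ (Rlt_le _ _ Hs)); field; auto.
      + assert (Hs' : (1 + Derive h t) / (1 - Derive h t) < 0) by lra.
        unfold Rdiv, Rminus in Hs'; rewrite (sign_eq_m1 _ Hs'), (Rabs_left _ Hs'); field; auto. }
  rewrite (is_derive_unique_iff _ _ _ _ Hd); unfold flatness_defect.
  set (h0 := h t) in *; set (h1 := Derive h t) in *; set (h2 := Derive (Derive h) t) in *.
  rewrite Rdiv_eq_iff; [ split; intros H; lra | | exact HD ].
  apply Rmult_integral_contrapositive_currified; assumption.
Qed.

(** The derivative on the left is [h'' / (1 + h'^2)], and [1 + h'^2] is
    [h'^2 + s] for [s = 1]. *)
Lemma solution2_equation : forall alpha beta h t,
  ex_derive (Derive h) t ->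
  (alpha^2 * (h t)^2 - beta^2 * t^2) * (alpha^2 * h t + beta^2 * t * Derive h t) <> 0 ->
  (is_derive (fun t => atan (Derive h t)) t
      (alpha^2 * beta^2 * (t * Derive h t - h t)^2
       / ((alpha^2 * (h t)^2 - beta^2 * t^2)
          * (alpha^2 * h t + beta^2 * t * Derive h t)))
   <-> flatness_defect 1 alpha beta (h t) (Derive h t) (Derive (Derive h) t) t 1 0 = 0).
Proof.
  intros alpha beta h t Hh HD.
  assert (Hd : is_derive (fun t => atan (Derive h t)) t
                 (Derive (Derive h) t / (1 + (Derive h t)^2))).
  { auto_derive; [ exact Hh | ].
    change (fun x : R => Derive h x) with (Derive h); field.
    generalize (pow2_ge_0 (Derive h t)); lra. }
  rewrite (is_derive_unique_iff _ _ _ _ Hd); unfold flatness_defect.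
  set (h0 := h t) in *; set (h1 := Derive h t) in *; set (h2 := Derive (Derive h) t) in *.
  rewrite Rdiv_eq_iff; [ split; intros H; lra | | exact HD ].
  generalize (pow2_ge_0 h1); lra.
Qed.

(** * Functions with finitely many derivatives on an open set *)

(** Only the existence of derivatives is asked, which suffices since all orders
    are used together.  Peeling off the first derivative, rather than the last
    one as [ex_derive_n] does, suits the product and chain rules: they express
    the first derivative through functions to which an induction hypothesis
    applies. *)
Fixpoint Ck (n : nat) (U : R -> Prop) (F : R -> R) : Prop :=
  match n with
  | O => True
  | S m => (forall x, U x -> ex_derive F x) /\ Ck m U (Derive F)
  end.

Lemma Derive_n_Derive : forall F n x, Derive_n (Derive F) n x = Derive_n F (S n) x.
Proof.
  intros F n x.
  change (Derive F) with (Derive_n F 1).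
  rewrite Derive_n_comp, Nat.add_comm; reflexivity.
Qed.

Lemma Ck_iff_ex_derive_n : forall n U F,
  Ck n U F <-> (forall k x, (k <= n)%nat -> U x -> ex_derive_n F k x).
Proof.
  induction n as [ | n IH]; intros U F; simpl.
  - split; [ | tauto ].
    intros _ k x Hk _; inversion Hk; exact I.
  - rewrite IH; split.
    + intros [H1 H2] [ | [ | k]] x Hk Hx; [ exact I | exact (H1 x Hx) | ].
      generalize (H2 (S k) x (le_S_n _ _ Hk) Hx).
      apply ex_derive_ext; intros y; apply Derive_n_Derive.
    + intros H; split.
      * intros x Hx; exact (H 1%nat x (le_n_S _ _ (Nat.le_0_l n)) Hx).
      * intros [ | k] x Hk Hx; [ exact I | ].
        generalize (H (S (S k)) x (le_n_S _ _ Hk) Hx).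
        apply ex_derive_ext; intros y; symmetry; apply Derive_n_Derive.
Qed.

Lemma Ck_ext : forall n U F G, open U -> (forall x, U x -> F x = G x) ->
  Ck n U F -> Ck n U G.
Proof.
  induction n as [ | n IH]; intros U F G HU Heq; simpl; [ tauto | ].
  assert (Hloc : forall x, U x -> locally x (fun y => F y = G y)).
  { intros x Hx; generalize (HU x Hx); apply filter_imp; exact Heq. }
  intros [H1 H2]; split.
  - intros x Hx; apply (ex_derive_ext_loc F G x (Hloc x Hx)), H1, Hx.
  - apply (IH U (Derive F)); auto.
    intros x Hx; apply Derive_ext_loc, Hloc, Hx.
Qed.

Lemma Ck_S : forall n U F, Ck (S n) U F -> Ck n U F.
Proof.
  induction n as [ | n IH]; intros U F [H1 H2]; [ exact I | ].
  split; [ exact H1 | apply IH, H2 ].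
Qed.

Lemma Ck_plus : forall n U F G, open U -> Ck n U F -> Ck n U G ->
  Ck n U (fun x => F x + G x).
Proof.
  induction n as [ | n IH]; intros U F G HU; simpl; [ tauto | ].
  intros [F1 F2] [G1 G2]; split.
  - intros x Hx; apply (ex_derive_plus (V := R_NormedModule)); auto.
  - apply (Ck_ext n U (fun x => Derive F x + Derive G x)); auto.
    intros x Hx; symmetry; apply Derive_plus; auto.
Qed.

Lemma Ck_mult : forall n U F G, open U -> Ck n U F -> Ck n U G ->
  Ck n U (fun x => F x * G x).
Proof.
  induction n as [ | n IH]; intros U F G HU HF HG; [ exact I | ].
  assert (HF' := Ck_S _ _ _ HF); assert (HG' := Ck_S _ _ _ HG).
  destruct HF as [F1 F2], HG as [G1 G2]; split.
  - intros x Hx; apply ex_derive_mult; auto.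
  - apply (Ck_ext n U (fun x => Derive F x * G x + F x * Derive G x)); auto.
    + intros x Hx; symmetry; apply Derive_mult; auto.
    + apply Ck_plus; auto.
Qed.

Lemma Ck_opp : forall n U F, open U -> Ck n U F -> Ck n U (fun x => - F x).
Proof.
  induction n as [ | n IH]; intros U F HU; simpl; [ tauto | ].
  intros [F1 F2]; split.
  - intros x Hx; apply (ex_derive_opp (V := R_NormedModule)); auto.
  - apply (Ck_ext n U (fun x => - Derive F x)); auto.
    intros x Hx; symmetry; apply Derive_opp.
Qed.

Lemma Ck_inv : forall n U F, open U -> (forall x, U x -> F x <> 0) ->
  Ck n U F -> Ck n U (fun x => / F x).
Proof.
  induction n as [ | n IH]; intros U F HU Hne HF; [ exact I | ].
  assert (HF' := Ck_S _ _ _ HF); destruct HF as [F1 F2]; split.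
  - intros x Hx; apply ex_derive_inv; auto.
  - apply (Ck_ext n U (fun x => - (Derive F x * (/ F x * / F x)))); auto.
    + intros x Hx; rewrite Derive_inv by auto; field; auto.
    + apply Ck_opp, Ck_mult, Ck_mult; auto.
Qed.

(** The class of composites [F o gi] is stable under derivation: with
    [gi' = 1 / (g' o gi)], the derivative is [(F' / g') o gi].  The induction thus
    varies [F] and never differentiates [gi] twice. *)
Lemma Ck_comp_inverse : forall n U V g gi F, open U -> open V ->
  (forall x, U x -> Derive g x <> 0) -> (forall k, Ck k U (Derive g)) ->
  (forall t, V t -> U (gi t) /\ is_derive gi t (/ Derive g (gi t))) ->
  Ck n U F -> Ck n V (fun t => F (gi t)).
Proof.
  induction n as [ | n IH]; intros U V g gi F HU HV Hne Hg Hgi HF; [ exact I | ].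
  destruct HF as [F1 F2].
  assert (Hd : forall t, V t ->
            is_derive (fun t => F (gi t)) t (Derive F (gi t) * / Derive g (gi t))).
  { intros t Ht; destruct (Hgi t Ht) as [Ut Dt].
    rewrite Rmult_comm.
    apply (is_derive_comp F gi t); [ apply Derive_correct; auto | exact Dt ]. }
  split.
  - intros t Ht; eexists; exact (Hd t Ht).
  - apply (Ck_ext n V (fun t => (fun x => Derive F x * / Derive g x) (gi t))); auto.
    + intros t Ht; symmetry; apply is_derive_unique, Hd, Ht.
    + apply (IH U V g gi (fun x => Derive F x * / Derive g x)); auto.
      apply Ck_mult; auto; apply Ck_inv; auto.
Qed.

(** * Inverting a function with nonvanishing derivative *)

(** Smoothness at an endpoint of [J] is that of an extension, so the inverse
    function must live on an open set.  The set of points joined to [J] by a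
    segment near which [P] holds is open, and it inherits convexity from [J]. *)
Lemma open_interval_around : forall (J P : R -> Prop),
  interval J -> (forall u, J u -> locally u P) ->
  exists U : R -> Prop, open U /\ (forall a b x, U a -> U b -> a <= x <= b -> U x)
    /\ (forall u, J u -> U u) /\ (forall x, U x -> P x).
Proof.
  intros J P [Hc _] HP.
  exists (fun x => exists u, J u /\ forall y, Rmin u x <= y <= Rmax u x -> locally y P).
  repeat split.
  - intros x (u & Hu & Hy).
    assert (Hx : locally x (fun y => locally y P))
      by (apply locally_locally, Hy; split; [ apply Rmin_r | apply Rmax_r ]).
    destruct Hx as [d Hd]; exists d; intros x' Hx'.
    exists u; split; [ exact Hu | ]; intros y Hyx'.
    apply Rabs_def2 in Hx'; unfold minus, plus, opp in Hx'; simpl in Hx'.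
    destruct (Rlt_or_le y (Rmin u x)) as [H1 | H1];
      [ | destruct (Rlt_or_le (Rmax u x) y) as [H2 | H2]; [ | apply Hy; lra ] ].
    + apply Hd, Rabs_def1; unfold minus, plus, opp; simpl;
      revert H1 Hyx'; unfold Rmin, Rmax; repeat destruct Rle_dec; lra.
    + apply Hd, Rabs_def1; unfold minus, plus, opp; simpl;
      revert H2 Hyx'; unfold Rmin, Rmax; repeat destruct Rle_dec; lra.
  - intros a b x (u & Hu & Ha) (w & Hw & Hb) Hx.
    destruct (Rle_or_lt x u) as [Hxu | Hxu].
    + exists u; split; [ exact Hu | ]; intros y Hy; apply Ha.
      rewrite Rmin_right, Rmax_left in * by lra; lra.
    + destruct (Rle_or_lt w x) as [Hwx | Hwx].
      * exists w; split; [ exact Hw | ]; intros y Hy; apply Hb.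
        rewrite Rmin_left, Rmax_right in * by lra; lra.
      * assert (Jx : J x) by (apply (Hc u w); auto; lra).
        exists x; split; [ exact Jx | ]; intros y Hy.
        rewrite Rmin_left, Rmax_left in Hy by lra.
        replace y with x by lra; auto.
  - intros u Hu; exists u; split; [ exact Hu | ]; intros y Hy.
    rewrite Rmin_left, Rmax_left in Hy by lra.
    replace y with u by lra; auto.
  - intros x (u & Hu & Hy); apply locally_singleton, Hy.
    split; [ apply Rmin_r | apply Rmax_r ].
Qed.

Lemma constant_sign : forall (U : R -> Prop) (F : R -> R),
  (forall a b x, U a -> U b -> a <= x <= b -> U x) ->
  (forall x, U x -> continuity_pt F x) -> (forall x, U x -> F x <> 0) ->
  exists c, c * c = 1 /\ forall x, U x -> 0 < c * F x.
Proof.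
  intros U F Hconv Hcont Hne.
  assert (Hsame : forall x y, x < y -> U x -> U y -> ~ F x * F y < 0).
  { intros x y Hxy Hx Hy Hneg.
    assert (HU : forall a, x <= a <= y -> U a) by (intros a Ha; exact (Hconv x y a Hx Hy Ha)).
    destruct (Rlt_or_le (F x) 0) as [H | H].
    - destruct (IVT_interv F x y) as (z & Hz & Hz0).
      + intros a Ha; apply Hcont, HU, Ha.
      + exact Hxy.
      + exact H.
      + nra.
      + exact (Hne z (HU z Hz) Hz0).
    - destruct (IVT_interv (fun a => - F a) x y) as (z & Hz & Hz0).
      + intros a Ha; apply continuity_pt_opp, Hcont, HU, Ha.
      + exact Hxy.
      + generalize (Hne x Hx); lra.
      + nra.
      + apply (Hne z (HU z Hz)); lra. }
  destruct (classic (exists x, U x)) as [(x0 & Hx0) | Hempty].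
  - assert (Hpos : forall x, U x -> 0 < F x0 * F x).
    { intros x Hx; assert (H0 := Hne x0 Hx0); assert (H1 := Hne x Hx).
      assert (Hp : F x0 * F x <> 0) by (apply Rmult_integral_contrapositive; auto).
      destruct (Rtotal_order x0 x) as [Hlt | [-> | Hgt]]; [ | nra | ].
      - specialize (Hsame x0 x Hlt Hx0 Hx); lra.
      - specialize (Hsame x x0 Hgt Hx Hx0); lra. }
    destruct (Rlt_or_le 0 (F x0)) as [H | H].
    + exists 1; split; [ ring | ]; intros x Hx; specialize (Hpos x Hx); nra.
    + exists (-1); split; [ ring | ]; intros x Hx; specialize (Hpos x Hx); nra.
  - exists 1; split; [ ring | ]; intros x Hx; exfalso; eauto.
Qed.

(** With the constant sign [c] of [g'] the function [c g] increases, so both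
    monotonicity cases are treated at once.  The intermediate value theorem on
    small intervals around [x0] shows that the image is open and that the
    inverse is continuous; its difference quotients are the inverses of those
    of [g]. *)
Lemma inverse_function : forall (U : R -> Prop) (g : R -> R), open U ->
  (forall a b x, U a -> U b -> a <= x <= b -> U x) ->
  (forall x, U x -> ex_derive g x) -> (forall x, U x -> continuity_pt (Derive g) x) ->
  (forall x, U x -> Derive g x <> 0) ->
  exists gi : R -> R,
    open (fun t => exists x, U x /\ g x = t)
    /\ (forall x, U x -> gi (g x) = x)
    /\ (forall x, U x -> is_derive gi (g x) (/ Derive g x)).
Proof.
  intros U g HU Hconv Hg Hg' Hne.
  destruct (constant_sign U (Derive g) Hconv Hg' Hne) as (c & Hc & Hpos).
  assert (Hc1 : c = 1 \/ c = -1) by (destruct (Req_dec c 1); [ tauto | right; nra ]).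
  assert (Hcont : forall x, U x -> continuity_pt g x)
    by (intros x Hx; apply continuity_pt_filterlim, (ex_derive_continuous g x), Hg, Hx).
  assert (Hmono : forall x y, U x -> U y -> x < y -> c * g x < c * g y).
  { intros x y Hx Hy Hxy.
    destruct (MVT_gen g x y (Derive g)) as (w & Hw & Heq).
    - intros w Hw; rewrite Rmin_left, Rmax_right in Hw by lra.
      apply Derive_correct, Hg, (Hconv x y); auto; lra.
    - intros w Hw; rewrite Rmin_left, Rmax_right in Hw by lra.
      apply Hcont, (Hconv x y); auto; lra.
    - rewrite Rmin_left, Rmax_right in Hw by lra.
      assert (Hw' := Hpos w (Hconv x y w Hx Hy Hw)); nra. }
  assert (Hinj : forall x y, U x -> U y -> g x = g y -> x = y).
  { intros x y Hx Hy Heq.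
    destruct (Rtotal_order x y) as [H | [H | H]]; [ | exact H | ];
      apply Hmono in H; auto; rewrite Heq in H; lra. }
  assert (Hsurj : forall x0 eps, U x0 -> 0 < eps -> exists d, 0 < d /\
    forall t, Rabs (t - g x0) < d -> exists x, U x /\ g x = t /\ Rabs (x - x0) < eps).
  { intros x0 eps Hx0 Heps.
    destruct (HU x0 Hx0) as [r Hr].
    set (e := Rmin r eps / 2).
    assert (He0 : 0 < Rmin r eps) by (apply Rmin_glb_lt; [ apply cond_pos | exact Heps ]).
    assert (He1 := Rmin_l r eps); assert (He2 := Rmin_r r eps).
    assert (HUe : forall x, Rabs (x - x0) <= e -> U x)
      by (intros x Hx; apply Hr; change (Rabs (x - x0) < r); unfold e in Hx; lra).
    assert (Hm : U (x0 - e)) by (apply HUe, Rabs_le; unfold e; lra).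
    assert (Hp : U (x0 + e)) by (apply HUe, Rabs_le; unfold e; lra).
    assert (M1 := Hmono (x0 - e) x0 Hm Hx0 ltac:(unfold e; lra)).
    assert (M2 := Hmono x0 (x0 + e) Hx0 Hp ltac:(unfold e; lra)).
    (* Values within this distance of [g x0] lie between those at the two ends
       of the interval of radius [e] around [x0]. *)
    exists (Rmin (c * g x0 - c * g (x0 - e)) (c * g (x0 + e) - c * g x0)); split.
    - apply Rmin_glb_lt; lra.
    - intros t Ht.
      assert (B1 := Rlt_le_trans _ _ _ Ht (Rmin_l _ _)).
      assert (B2 := Rlt_le_trans _ _ _ Ht (Rmin_r _ _)).
      apply Rabs_def2 in B1; apply Rabs_def2 in B2.
      destruct (IVT_interv (fun x => c * g x - c * t) (x0 - e) (x0 + e)) as (x & Hx & Hx0').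
      + intros a Ha; apply continuity_pt_minus;
          [ | apply continuity_pt_const; intros ? ?; reflexivity ].
        apply continuity_pt_scal, Hcont, HUe, Rabs_le; lra.
      + unfold e; lra.
      + destruct Hc1 as [-> | ->]; lra.
      + destruct Hc1 as [-> | ->]; lra.
      + exists x; repeat split.
        * apply HUe, Rabs_le; lra.
        * assert (c * (c * g x) = c * (c * t)) by (f_equal; lra).
          rewrite <- !Rmult_assoc, Hc in H; lra.
        * apply Rabs_def1; unfold e in *; lra. }
  set (gi := fun t => epsilon (inhabits 0) (fun x => U x /\ g x = t)).
  assert (Hgi : forall x, U x -> gi (g x) = x).
  { intros x Hx.
    assert (Hs : U (gi (g x)) /\ g (gi (g x)) = g x)
      by (apply (epsilon_spec (inhabits 0) (fun y => U y /\ g y = g x)); exists x; auto).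
    destruct Hs; apply Hinj; auto. }
  exists gi; split; [ | split; [ exact Hgi | ] ].
  - intros t (x0 & Hx0 & <-).
    destruct (Hsurj x0 1 Hx0 Rlt_0_1) as (d & Hd & H).
    exists (mkposreal d Hd); intros t Ht.
    destruct (H t Ht) as (x & Hx & Hxt & _); exists x; auto.
  - intros x0 Hx0; apply is_derive_Reals; intros eps Heps.
    assert (Hinv : continuity_pt (fun y => / y) (Derive g x0))
      by (apply continuity_pt_inv; [ apply continuity_pt_id | apply Hne, Hx0 ]).
    destruct (Hinv eps Heps) as (e & He & Hinve).
    destruct (proj1 (is_derive_Reals g x0 _) (Derive_correct g x0 (Hg x0 Hx0)) e He)
      as (d1 & Hd1).
    destruct (Hsurj x0 d1 Hx0 (cond_pos d1)) as (d & Hd & H).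
    exists (mkposreal d Hd); intros k Hk Hkd; simpl in Hkd.
    destruct (H (g x0 + k)) as (x & Hx & Hxk & Hxd);
      [ replace (g x0 + k - g x0) with k by ring; exact Hkd | ].
    rewrite <- Hxk, !Hgi by assumption.
    assert (Hxx0 : x - x0 <> 0) by (intros E; apply Hk; replace x with x0 in Hxk by lra; lra).
    specialize (Hd1 (x - x0) Hxx0 Hxd).
    replace (x0 + (x - x0)) with x in Hd1 by ring.
    replace (g x - g x0) with k in Hd1 by lra.
    replace ((x - x0) / k) with (/ (k / (x - x0))) by (field; auto).
    destruct (Req_dec (k / (x - x0)) (Derive g x0)) as [-> | Hneq].
    + rewrite Rminus_eq_0, Rabs_R0; exact Heps.
    + apply Hinve; split; [ split; [ exact I | auto ] | exact Hd1 ].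
Qed.

(** The function [h] is defined on the image of an open interval containing [J],
    which makes it smooth at the endpoints of [I] too. *)
Lemma exists_graph_over : forall J f g,
  interval J -> smooth_on J f -> smooth_on J g ->
  (forall u, J u -> Derive g u <> 0) ->
  exists I h, interval I /\ smooth_on I h /\ graph_over J f g I h.
Proof.
  intros J f g HJ Hf Hg Hne.
  destruct (open_interval_around J (fun x =>
      (forall n, ex_derive_n f n x) /\ (forall n, ex_derive_n g n x) /\ Derive g x <> 0))
    as (U & HU & Hconv & HJU & HP); auto.
  { intros u Hu; apply filter_and; [ exact (Hf u Hu) | apply filter_and; [ exact (Hg u Hu) | ] ].
    apply locally_neq_0; [ apply (smooth_on_derive J g u Hg Hu) | auto ]. }
  assert (Cf : forall n, Ck n U f)
    by (intros n; apply Ck_iff_ex_derive_n; intros k x _ Hx; apply (HP x Hx)).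
  assert (Cg : forall n, Ck n U g)
    by (intros n; apply Ck_iff_ex_derive_n; intros k x _ Hx; apply (HP x Hx)).
  assert (Hg0 : forall x, U x -> ex_derive g x) by (intros x Hx; apply (Cg 1%nat), Hx).
  assert (Hg1 : forall x, U x -> continuity_pt (Derive g) x).
  { intros x Hx; apply continuity_pt_filterlim, (ex_derive_continuous (Derive g) x).
    apply (Cg 2%nat), Hx. }
  assert (HUne : forall x, U x -> Derive g x <> 0) by (intros x Hx; apply (HP x Hx)).
  destruct (inverse_function U g HU Hconv Hg0 Hg1 HUne) as (gi & HV & Hgi & Dgi).
  exists (fun t => exists u, J u /\ g u = t), (fun t => f (gi t)).
  split; [ | split ].
  - split.
    + intros a b x (p & Hp & <-) (q & Hq & <-) Hx.
      destruct (Req_dec (g p) x) as [<- | Hpx]; [ exists p; auto | ].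
      destruct (Req_dec x (g q)) as [-> | Hxq]; [ exists q; auto | ].
      assert (Hpq : p <> q) by (intros ->; lra).
      assert (Hcont : forall y, J y -> continuity_pt g y)
        by (intros y Hy; apply continuity_pt_filterlim, (ex_derive_continuous g y); auto).
      destruct HJ as [HJc _].
      destruct (Rtotal_order p q) as [Hlt | [Heq | Hgt]]; [ | contradiction | ].
      * destruct (IVT_interv (fun y => g y - x) p q) as (y & Hy & Hy0); try lra.
        -- intros a Ha; apply continuity_pt_minus;
             [ apply Hcont, (HJc p q); auto | apply continuity_pt_const; intros ? ?; reflexivity ].
        -- exists y; split; [ apply (HJc p q); auto | lra ].
      * destruct (IVT_interv (fun y => x - g y) q p) as (y & Hy & Hy0); try lra.
        -- intros a Ha; apply continuity_pt_minus;
             [ apply continuity_pt_const; intros ? ?; reflexivity | apply Hcont, (HJc q p); auto ].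
        -- exists y; split; [ apply (HJc q p); auto | lra ].
    + destruct HJ as [_ (a & b & Ha & Hb & Hab)].
      assert (Hgab : g a <> g b)
        by (intros E; assert (a = b) by (rewrite <- (Hgi a), <- (Hgi b), E; auto); lra).
      destruct (Rtotal_order (g a) (g b)) as [H | [H | H]]; [ | contradiction | ].
      * exists (g a), (g b); repeat split; [ exists a | exists b | ]; auto.
      * exists (g b), (g a); repeat split; [ exists b | exists a | ]; auto.
  - intros t (u & Hu & <-).
    assert (Ht : exists x, U x /\ g x = g u) by (exists u; auto).
    generalize (HV _ Ht); apply filter_imp; intros t Vt n.
    apply (proj1 (Ck_iff_ex_derive_n n (fun t => exists x, U x /\ g x = t) (fun t => f (gi t))));
      [ | exact (le_n n) | exact Vt ].
    apply (Ck_comp_inverse n U _ g gi f); auto.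
    + intros k; exact (proj2 (Cg (S k))).
    + intros y (x & Hx & <-); rewrite (Hgi x Hx); auto.
  - repeat split; auto.
    intros u Hu; rewrite Hgi; auto.
Qed.

(** * Inflection points *)

(** If [f] and [f'] vanish at [u], the first two coordinate directions form an
    orthonormal normal frame at the point, and [z_uv] and [z_vv] have no component
    along it.  Each determinant has a factor [c12] or [c22] in each of its terms,
    so all of them vanish.  The last two coordinates are arbitrary, and both types
    of surfaces are covered. *)
Lemma inflection_free_rotation : forall alpha (p q : R -> R -> R) J f u,
  inflection_free J (fun u v => Vec4 (f u * cos (alpha * v)) (f u * sin (alpha * v))
                                     (p u v) (q u v)) ->
  J u -> ~ (f u = 0 /\ Derive f u = 0).
Proof.
  intros alpha p q J f u.
  set (z := fun u v => Vec4 (f u * cos (alpha * v)) (f u * sin (alpha * v)) (p u v) (q u v)).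
  intros H Hu [F0 F1].
  assert (Hu1 : forall v, x1 (pdv du z u v) = 0 /\ x2 (pdv du z u v) = 0).
  { intros v; simpl; rewrite !Derive_scal_l, F1; split; ring. }
  assert (Hv1 : forall v, x1 (pdv dv z u v) = 0 /\ x2 (pdv dv z u v) = 0).
  { intros v; simpl; destruct (Derive_trig (f u) alpha v) as (-> & -> & _).
    rewrite F0; split; ring. }
  assert (H2 : forall i, x1 (pdv dv (pdv i z) u 0) = 0 /\ x2 (pdv dv (pdv i z) u 0) = 0).
  { intros i; split;
      [ change (Derive (fun v => x1 (pdv i z u v)) 0 = 0)
      | change (Derive (fun v => x2 (pdv i z u v)) 0 = 0) ];
      rewrite (Derive_ext _ (fun _ => 0)); try apply Derive_const;
      intros v; destruct i; (apply Hu1 || apply Hv1). }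
  assert (Hn : forall n1 n2 w, x1 w = 0 -> x2 w = 0 ->
            mink w (Vec4 n1 n2 0 0) = 0 /\ mink (Vec4 n1 n2 0 0) w = 0)
    by (intros n1 n2 w W1 W2; unfold mink; simpl; rewrite W1, W2; split; ring).
  apply (H u 0 (Vec4 1 0 0 0) (Vec4 0 1 0 0) Hu); [ generalize PI_RGT_0; lra | | ].
  - repeat split; try (unfold mink; simpl; ring);
      apply Hn; destruct i; (apply Hu1 || apply Hv1).
  - rewrite !(fun a b i => proj1 (Hn a b _ (proj1 (H2 i)) (proj2 (H2 i)))).
    repeat split; ring.
Qed.

(** * Flat meridians and solutions of the differential equations *)

(** These are the quantities by which the flatness relation is divided in order
    to reach the differential equation. *)
Lemma defect_graph_pivot : forall s alpha beta J f g I h,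
  0 < alpha -> 0 < beta ->
  interval J -> smooth_on J f -> smooth_on J g -> smooth_on I h ->
  (forall u, J u -> (Derive f u)^2 + s * (Derive g u)^2 <> 0
    /\ alpha^2 * (f u)^2 - s * beta^2 * (g u)^2 <> 0) ->
  (forall u, J u -> ~ (f u = 0 /\ Derive f u = 0)) ->
  (forall u, J u -> curve_defect s alpha beta f g u = 0) ->
  graph_over J f g I h -> forall t, I t ->
  (Derive h t)^2 + s <> 0
  /\ alpha^2 * (h t)^2 - s * beta^2 * t^2 <> 0
  /\ alpha^2 * h t + beta^2 * t * Derive h t <> 0.
Proof.
  intros s alpha beta J f g I h Ha Hb HJ Hf Hg Hh Hn Hff HQ Hgr t Ht.
  assert (HC := graph_over_chain_rule J f g I h HJ Hf Hg Hh Hgr).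
  destruct Hgr as (Hne & HI & Heq); apply HI in Ht; destruct Ht as (u & Hu & <-).
  destruct (Hn u Hu) as [HE HG].
  assert (HN := flatness_defect_pivot s alpha beta _ _ _ _ _ _ Ha Hb (Hne u Hu) HE HG
                  (Hff u Hu) (HQ u Hu)).
  destruct (HC u Hu) as [H1 _].
  rewrite H1, (Heq u Hu) in HN; rewrite H1 in HE; rewrite (Heq u Hu) in HG.
  repeat split.
  - intros K; apply HE.
    transitivity ((Derive g u)^2 * ((Derive h (g u))^2 + s)); [ ring | rewrite K; ring ].
  - exact HG.
  - intros K; apply HN.
    transitivity (Derive g u * (alpha^2 * h (g u) + beta^2 * g u * Derive h (g u)));
      [ ring | rewrite K; ring ].
Qed.

Lemma graph_meridian1_iff_defect : forall J alpha beta f g,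
  interval J -> 0 < alpha -> 0 < beta -> smooth_on J f -> smooth_on J g ->
  (forall u, J u -> (Derive f u)^2 + -1 * (Derive g u)^2 <> 0
    /\ alpha^2 * (f u)^2 - -1 * beta^2 * (g u)^2 <> 0) ->
  (forall u, J u -> ~ (f u = 0 /\ Derive f u = 0)) ->
  (graph_meridian1 alpha beta J f g <->
   (forall u, J u -> Derive g u <> 0)
   /\ (forall u, J u -> curve_defect (-1) alpha beta f g u = 0)).
Proof.
  intros J alpha beta f g HJ Ha Hb Hf Hg Hn Hff; split.
  - intros (I & h & _ & Hrep & Hh & Hode).
    apply reparametrizes_meridian1 in Hrep; [ | assumption | assumption ].
    split; [ exact (proj1 Hrep) | ].
    apply (proj2 (graph_over_defect _ _ _ J f g I h HJ Hf Hg Hh Hrep)).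
    intros t Ht; destruct (Hode t Ht) as (Hp & Hm & HD & Hder).
    apply solution1_equation; auto; apply (smooth_on_derive I h t Hh Ht).
  - intros [Hne HQ].
    destruct (exists_graph_over J f g HJ Hf Hg Hne) as (I & h & HI & Hh & Hgr).
    exists I, h; split; [ exact HI | split; [ apply reparametrizes_meridian1; assumption | ] ].
    split; [ exact Hh | intros t Ht ].
    destruct (defect_graph_pivot (-1) alpha beta J f g I h Ha Hb HJ Hf Hg Hh Hn Hff HQ Hgr t Ht)
      as (HE & HG & HN).
    assert (Hp : 1 + Derive h t <> 0) by (intros K; apply HE; nra).
    assert (Hm : 1 - Derive h t <> 0) by (intros K; apply HE; nra).
    assert (HD : (alpha^2 * h t + beta^2 * t * Derive h t)
                 * (alpha^2 * (h t)^2 + beta^2 * t^2) <> 0)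
      by (apply Rmult_integral_contrapositive_currified; [ exact HN | lra ]).
    split; [ exact Hp | split; [ exact Hm | split; [ exact HD | ] ] ].
    apply solution1_equation; auto; [ apply (smooth_on_derive I h t Hh Ht) | ].
    apply (proj1 (graph_over_defect (-1) alpha beta J f g I h HJ Hf Hg Hh Hgr)); auto.
Qed.

Lemma graph_meridian2_iff_defect : forall J alpha beta f g,
  interval J -> 0 < alpha -> 0 < beta -> smooth_on J f -> smooth_on J g ->
  (forall u, J u -> (Derive f u)^2 + 1 * (Derive g u)^2 <> 0
    /\ alpha^2 * (f u)^2 - 1 * beta^2 * (g u)^2 <> 0) ->
  (forall u, J u -> ~ (f u = 0 /\ Derive f u = 0)) ->
  (graph_meridian2 alpha beta J f g <->
   (forall u, J u -> Derive g u <> 0)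
   /\ (forall u, J u -> curve_defect 1 alpha beta f g u = 0)).
Proof.
  intros J alpha beta f g HJ Ha Hb Hf Hg Hn Hff; split.
  - intros (I & h & _ & Hrep & Hh & Hode).
    apply reparametrizes_meridian2 in Hrep; [ | assumption | assumption ].
    split; [ exact (proj1 Hrep) | ].
    apply (proj2 (graph_over_defect _ _ _ J f g I h HJ Hf Hg Hh Hrep)).
    intros t Ht; destruct (Hode t Ht) as (HD & Hder).
    apply solution2_equation; auto; apply (smooth_on_derive I h t Hh Ht).
  - intros [Hne HQ].
    destruct (exists_graph_over J f g HJ Hf Hg Hne) as (I & h & HI & Hh & Hgr).
    exists I, h; split; [ exact HI | split; [ apply reparametrizes_meridian2; assumption | ] ].
    split; [ exact Hh | intros t Ht ].
    destruct (defect_graph_pivot 1 alpha beta J f g I h Ha Hb HJ Hf Hg Hh Hn Hff HQ Hgr t Ht)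
      as (HE & HG & HN).
    assert (HD : (alpha^2 * (h t)^2 - beta^2 * t^2)
                 * (alpha^2 * h t + beta^2 * t * Derive h t) <> 0)
      by (apply Rmult_integral_contrapositive_currified; [ lra | exact HN ]).
    split; [ exact HD | ].
    apply solution2_equation; auto; [ apply (smooth_on_derive I h t Hh Ht) | ].
    apply (proj1 (graph_over_defect 1 alpha beta J f g I h HJ Hf Hg Hh Hgr)); auto.
Qed.

Lemma smooth_on_subset : forall (J J' : R -> Prop) f,
  (forall u, J' u -> J u) -> smooth_on J f -> smooth_on J' f.
Proof. intros J J' f Hs Hf u Hu; exact (Hf u (Hs u Hu)). Qed.

(** If [g'] vanished on a neighbourhood of [u] in [J], then [g''(u) = 0] as well,
    and the defect at [u] would be [- alpha^2 beta^2 f'^4 g^2].  Here [f' <> 0]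
    because [E <> 0], and [g <> 0] because [G < 0]. *)
Lemma flat_profile_not_constant : forall alpha beta J f g u eps,
  0 < alpha -> 0 < beta -> interval J -> smooth_on J f -> smooth_on J g ->
  (forall u, J u -> (Derive f u)^2 + 1 * (Derive g u)^2 <> 0
    /\ alpha^2 * (f u)^2 - 1 * beta^2 * (g u)^2 < 0) ->
  (forall u, J u -> curve_defect 1 alpha beta f g u = 0) ->
  J u -> 0 < eps ->
  exists w, J w /\ Rabs (w - u) < eps /\ Derive g w <> 0.
Proof.
  intros alpha beta J f g u eps Ha Hb HJ Hf Hg Hn HQ Hu Heps.
  destruct (classic (exists w, J w /\ Rabs (w - u) < eps /\ Derive g w <> 0))
    as [H | H]; [ exact H | exfalso ].
  set (J' := fun x => J x /\ Rabs (x - u) < eps).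
  assert (HJ' : interval J') by (apply interval_ball; assumption).
  assert (Hu' : J' u) by (split; [ exact Hu | rewrite Rminus_eq_0, Rabs_R0; exact Heps ]).
  assert (H1 : forall w, J' w -> Derive g w = 0)
    by (intros w [Hw Hwu]; apply NNPP; intros K; apply H; exists w; auto).
  assert (H2 : Derive (Derive g) u = 0).
  { rewrite <- (Derive_const 0 u).
    apply (Derive_eq_on_interval J'); auto.
    - apply (smooth_on_derive J g u Hg Hu).
    - apply ex_derive_const. }
  specialize (HQ u Hu); destruct (Hn u Hu) as [HE HG].
  unfold curve_defect, flatness_defect in HQ.
  rewrite (H1 u Hu') in *; rewrite H2 in HQ.
  set (f0 := f u) in *; set (f1 := Derive f u) in *; set (g0 := g u) in *.
  assert (Hp : alpha^2 * beta^2 * (f1^2 * (f1^2 * g0^2)) = 0) by lra.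
  assert (HA : 0 < alpha^2) by (apply pow_lt; assumption).
  assert (HB : 0 < beta^2) by (apply pow_lt; assumption).
  assert (Hf1 : f1 <> 0) by (intros K; apply HE; rewrite K; ring).
  assert (Hg0 : g0 <> 0)
    by (intros K; rewrite K in HG; generalize (pow2_ge_0 f0); nra).
  revert Hp; repeat apply Rmult_integral_contrapositive_currified;
    try apply pow_nonzero; lra.
Qed.

Lemma zero_of_nearby_zeros : forall F u, continuity_pt F u ->
  (forall eps, 0 < eps -> exists w, Rabs (w - u) < eps /\ F w = 0) -> F u = 0.
Proof.
  intros F u HF H; apply NNPP; intros Hne.
  destruct (HF _ (Rabs_pos_lt _ Hne)) as (d & Hd & Hclose).
  destruct (H d Hd) as (w & Hw & Fw).
  assert (Hwu : u <> w) by (intros <-; contradiction).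
  specialize (Hclose w (conj (conj I Hwu) Hw)).
  simpl in Hclose; unfold Rdist in Hclose.
  rewrite Fw, Rminus_0_l, Rabs_Ropp in Hclose; lra.
Qed.

Lemma continuity_pt_curve_defect : forall s alpha beta J f g u,
  smooth_on J f -> smooth_on J g -> J u ->
  continuity_pt (curve_defect s alpha beta f g) u.
Proof.
  intros s alpha beta J f g u Hf Hg Hu.
  destruct (smooth_on_derive J f u Hf Hu) as (Hf1 & Hf2 & Hf3).
  destruct (smooth_on_derive J g u Hg Hu) as (Hg1 & Hg2 & Hg3).
  apply continuity_pt_filterlim, (ex_derive_continuous (curve_defect s alpha beta f g) u).
  unfold curve_defect, flatness_defect; auto_derive; repeat split; assumption.
Qed.

(** A point with [g' <> 0] has a neighbourhood in [J] that is a graph, so the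
    equation gives a zero of the defect there; the remaining points are limits
    of such points. *)
Lemma piecewise_graph_meridian2_iff_defect : forall J alpha beta f g,
  interval J -> 0 < alpha -> 0 < beta -> smooth_on J f -> smooth_on J g ->
  (forall u, J u -> (Derive f u)^2 + 1 * (Derive g u)^2 <> 0
    /\ alpha^2 * (f u)^2 - 1 * beta^2 * (g u)^2 < 0) ->
  (forall u, J u -> ~ (f u = 0 /\ Derive f u = 0)) ->
  (piecewise_graph_meridian2 alpha beta J f g <->
   (forall u, J u -> curve_defect 1 alpha beta f g u = 0)).
Proof.
  intros J alpha beta f g HJ Ha Hb Hf Hg Hn Hff.
  assert (Hsub : forall J', interval J' -> (forall u, J' u -> J u) ->
    (graph_meridian2 alpha beta J' f g <->
     (forall u, J' u -> Derive g u <> 0)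
     /\ (forall u, J' u -> curve_defect 1 alpha beta f g u = 0))).
  { intros J' HJ' Hs; apply graph_meridian2_iff_defect; auto;
      try (eapply smooth_on_subset; eassumption).
    intros u Hu; destruct (Hn u (Hs u Hu)); split; lra. }
  split.
  - intros [Hdense Hpieces].
    assert (Hreg : forall w, J w -> Derive g w <> 0 -> curve_defect 1 alpha beta f g w = 0).
    { intros w Hw Hgw.
      destruct (locally_neq_0 (Derive g) w) as [d Hd];
        [ apply (smooth_on_derive J g w Hg Hw) | exact Hgw | ].
      set (J' := fun x => J x /\ Rabs (x - w) < d).
      assert (HJ' : interval J') by (apply interval_ball; [ | | apply cond_pos ]; assumption).
      assert (Hs : forall x, J' x -> J x) by (intros x [Hx _]; exact Hx).
      apply (Hsub J' HJ' Hs).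
      - apply Hpieces; auto.
        intros x [_ Hx]; apply Hd; exact Hx.
      - split; [ exact Hw | rewrite Rminus_eq_0, Rabs_R0; apply cond_pos ]. }
    intros u Hu; apply zero_of_nearby_zeros.
    + apply (continuity_pt_curve_defect _ _ _ J); assumption.
    + intros eps Heps; destruct (Hdense u eps Hu Heps) as (w & Hw & Hwu & Hgw).
      exists w; auto.
  - intros HQ; split.
    + intros u eps Hu Heps; apply (flat_profile_not_constant alpha beta J f g); assumption.
    + intros J' HJ' Hs Hne; apply Hsub; auto.
Qed.

Theorem theorem4p1 :
  forall (J : R -> Prop) (alpha beta : R) (f g : R -> R),
    interval J -> 0 < alpha -> 0 < beta -> smooth_on J f -> smooth_on J g ->
    (* (i) *)
    ((forall u : R, J u ->
        (Derive f u)^2 - (Derive g u)^2 < 0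
        /\ alpha^2 * (f u)^2 + beta^2 * (g u)^2 > 0) ->
     inflection_free J (surf1 alpha beta f g) ->
     (flat J (surf1 alpha beta f g) <-> graph_meridian1 alpha beta J f g))
    /\
    (* (ii) *)
    ((forall u : R, J u ->
        alpha^2 * (f u)^2 - beta^2 * (g u)^2 < 0
        /\ (Derive f u)^2 + (Derive g u)^2 > 0) ->
     inflection_free J (surf2 alpha beta f g) ->
     (flat J (surf2 alpha beta f g) <-> piecewise_graph_meridian2 alpha beta J f g)
     /\
     (flat J (surf2 alpha beta f g) /\ (forall u : R, J u -> Derive g u <> 0)
      <-> graph_meridian2 alpha beta J f g)).
Proof.
  intros J alpha beta f g HJ Ha Hb Hf Hg; split.
  - intros Hsign Hinf.
    assert (Hn : forall u, J u -> (Derive f u)^2 + -1 * (Derive g u)^2 <> 0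
                 /\ alpha^2 * (f u)^2 - -1 * beta^2 * (g u)^2 <> 0)
      by (intros u Hu; destruct (Hsign u Hu); split; lra).
    assert (Hff : forall u, J u -> ~ (f u = 0 /\ Derive f u = 0))
      by (intros u; exact (inflection_free_rotation _ _ _ J f u Hinf)).
    rewrite (flat_iff_defect _ (-1) alpha beta f g J) by
      (auto using rotational_metric_surf1; ring).
    rewrite graph_meridian1_iff_defect by assumption.
    split; [ | tauto ]; intros HQ; split; [ | exact HQ ].
    intros u Hu K; destruct (Hsign u Hu) as [HE _].
    rewrite K in HE; generalize (pow2_ge_0 (Derive f u)); lra.
  - intros Hsign Hinf.
    assert (Hn : forall u, J u -> (Derive f u)^2 + 1 * (Derive g u)^2 <> 0
                 /\ alpha^2 * (f u)^2 - 1 * beta^2 * (g u)^2 < 0)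
      by (intros u Hu; destruct (Hsign u Hu); split; lra).
    assert (Hn' : forall u, J u -> (Derive f u)^2 + 1 * (Derive g u)^2 <> 0
                  /\ alpha^2 * (f u)^2 - 1 * beta^2 * (g u)^2 <> 0)
      by (intros u Hu; destruct (Hn u Hu); split; lra).
    assert (Hff : forall u, J u -> ~ (f u = 0 /\ Derive f u = 0))
      by (intros u; exact (inflection_free_rotation _ _ _ J f u Hinf)).
    rewrite (flat_iff_defect _ 1 alpha beta f g J) by
      (auto using rotational_metric_surf2; ring).
    rewrite piecewise_graph_meridian2_iff_defect, graph_meridian2_iff_defect by assumption.
    tauto.
Qed.
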